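(* Let $\mathbf{k}$ be a unital commutative ring and let $\Omega=\bigcup_{n\ge0}\Omega_n$ be a signature containing at least one $n$-ary operation with $n\ge2$. Let $\mathcal{A}$ and $\mathcal{B}$ be finite prime (in particular, simple) $\Omega$-algebras over $\mathbf{k}$ satisfying the same set of polynomial identities, i.e. $\mathrm{Id}(\mathcal{A})=\mathrm{Id}(\mathcal{B})$. Then $\mathcal{A}\cong\mathcal{B}$ as $\Omega$-algebras over $\mathbf{k}$.
   Context: An $\Omega$-algebra over $\mathbf{k}$ is a $\mathbf{k}$-module $\mathcal{A}$ in which every $\omega\in\Omega_n$ defines a $\mathbf{k}$-multilinear map $\omega:\mathcal{A}^n\to\mathcal{A}$ (for $n=0$, a distinguished element of $\mathcal{A}$). Homomorphisms are $\mathbf{k}$-linear maps preserving all operations. An ideal of $\mathcal{A}$ is a $\mathbf{k}$-submodule $I$ such that $\omega(a_1,\dots,a_n)\in I$ for all $n>0$, $\omega\in\Omega_n$, and $a_1,\dots,a_n\in\mathcal{A}$ with at least one $a_i\in I$. The free $\Omega$-algebra $\mathbf{k}_\Omega\langle X\rangle$, $X=\{x_1,x_2,\dots\}$, is the free $\mathbf{k}$-module on the set $M_\Omega(X)$ of monomials, where $M_\Omega(X)$ is the smallest set of formal expressions containing $X$ and $\Omega_0$ and closed under forming $\omega(y_1,\dots,y_n)$ for $\omega\in\Omega_n$. Its elements are called polynomials. A polynomial in given variables is multilinear if each of these variables occurs exactly once in each of its monomials. A polynomial $f(x_1,\dots,x_m)$ is a polynomial identity of $\mathcal{A}$ if $f(a_1,\dots,a_m)=0$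 for all $a_i\in\mathcal{A}$; $\mathrm{Id}(\mathcal{A})$ is the set of all of them. For nonempty subsets $\mathcal{S}_1,\dots,\mathcal{S}_m\subseteq\mathcal{A}$ ($m\ge2$), $\mathcal{S}_1\cdot\ldots\cdot\mathcal{S}_m$ is the $\mathbf{k}$-span of all elements $f(s_1,\dots,s_m,a_1,\dots,a_t)$ with $t\ge 0$, $f(x_1,\dots,x_{m+t})\in\mathbf{k}_\Omega\langle X\rangle$ multilinear, $s_i\in\mathcal{S}_i$, $a_j\in\mathcal{A}$; $\mathcal{S}^2=\mathcal{S}\cdot\mathcal{S}$. The algebra $\mathcal{A}$ is prime if $I\cdot J\neq0$ for every pair of nonzero ideals $I,J$ of $\mathcal{A}$; it is simple if $\mathcal{A}^2\ne0$ and its only ideals are $0$ and $\mathcal{A}$. *)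

(* Defs.v *)
From HB Require Import structures.
From mathcomp Require Import all_boot all_order all_algebra.
From mathcomp Require Import finmap monalg.
From mathcomp Require Import boolp classical_sets functions cardinality.

Set Implicit Arguments.
Unset Strict Implicit.
Unset Printing Implicit Defensive.

Import GRing.Theory.
Local Open Scope classical_set_scope.
Local Open Scope ring_scope.

(* [Om n] is the set of n-ary operation symbols. An n-tuple of elements of [A]
   is a function ['I_n -> A], so that an operation of arity 0 amounts to a
   distinguished element; [dfwith a x], for [x] of type [A] attached to the
   index [i], is [a] with its i-th entry replaced by [x]. *)
HB.mixin Record isOmegaAlg (k : comPzRingType) (Om : nat -> Type) A
    of GRing.Lmodule k A := {
  op : forall n : nat, Om n -> ('I_n -> A) -> A;
  op_multilinear : forall (n : nat) (w : Om n) (a : 'I_n -> A) (i : 'I_n),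
    linear (fun x : A => op n w (@dfwith 'I_n (fun=> A) a i x))
}.

#[short(type="omegaAlgType")]
HB.structure Definition OmegaAlg (k : comPzRingType) (Om : nat -> Type) :=
  { A of isOmegaAlg k Om A & GRing.Lmodule k A }.

Arguments op {k Om s n} w a : rename.

(* The countable alphabet x_1, x_2, ... is indexed from 0. *)
Inductive monomial (Om : nat -> Type) : Type :=
| MVar (i : nat)
| MOp (n : nat) (w : Om n) (u : 'I_n -> monomial Om).

(* [{malg k[M]}] needs a choiceType of monomials. *)
HB.instance Definition _ (Om : nat -> Type) := gen_eqMixin (monomial Om).
HB.instance Definition _ (Om : nat -> Type) := gen_choiceMixin (monomial Om).

(* The free k-module on the monomials: finitely supported functions. *)
Definition omegaPoly (k : comPzRingType) (Om : nat -> Type) : Type :=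
  {malg k[monomial Om]}.

Fixpoint occ (Om : nat -> Type) (i : nat) (u : monomial Om) : nat :=
  match u with
  | MVar j => if j == i then 1%N else 0%N
  | MOp n _ us => (\sum_(j < n) occ i (us j))%N
  end.

(* [f] is multilinear in the first [n] variables and involves no others. *)
Definition multilinear (k : comPzRingType) (Om : nat -> Type) (n : nat)
    (f : omegaPoly k Om) : Prop :=
  forall u : monomial Om, u \in msupp f ->
    forall i : nat, occ i u = if (i < n)%N then 1%N else 0%N.

Section OmegaAlgebra.
Context {k : comPzRingType} {Om : nat -> Type} {A : omegaAlgType k Om}.

Fixpoint evalm (v : nat -> A) (u : monomial Om) : A :=
  match u with
  | MVar i => v i
  | MOp _ w us => op w (fun j => evalm v (us j))
  end.

Definition evalp (v : nat -> A) (f : omegaPoly k Om) : A :=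
  \sum_(u <- msupp f) f@_u *: evalm v u.

Definition submodule (I : set A) : Prop :=
  I 0 /\ forall (c : k) (x y : A), I x -> I y -> I (c *: x + y).

Definition span (S : set A) : set A := smallest submodule S.

Definition ideal (I : set A) : Prop :=
  submodule I /\
  forall (n : nat) (w : Om n) (a : 'I_n -> A),
    (exists i : 'I_n, I (a i)) -> I (op w a).

(* The product S_1 ... S_m; the variables m, ..., m + t - 1 are free to take
   any values in A. *)
Definition set_prod (m : nat) (S : 'I_m -> set A) : set A :=
  span [set y | exists (t : nat) (f : omegaPoly k Om) (v : nat -> A),
    [/\ multilinear (m + t) f, forall i : 'I_m, S i (v i) & y = evalp v f]].

Definition set_mul (S T : set A) : set A :=
  set_prod (fun i : 'I_2 => if i == ord0 then S else T).

End OmegaAlgebra.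

Definition polyId (k : comPzRingType) (Om : nat -> Type)
    (A : omegaAlgType k Om) : set (omegaPoly k Om) :=
  [set f | forall v : nat -> A, evalp v f = 0].

Definition prime_alg (k : comPzRingType) (Om : nat -> Type)
    (A : omegaAlgType k Om) : Prop :=
  forall I J : set A, ideal I -> ideal J ->
    I <> [set 0] -> J <> [set 0] -> set_mul I J <> [set 0].

Definition simple_alg (k : comPzRingType) (Om : nat -> Type)
    (A : omegaAlgType k Om) : Prop :=
  set_mul [set: A] [set: A] <> [set 0] /\
  forall I : set A, ideal I -> I = [set 0] \/ I = [set: A].

Definition omega_iso (k : comPzRingType) (Om : nat -> Type)
    (A B : omegaAlgType k Om) : Prop :=
  exists f : {linear A -> B}, bijective f /\
    forall (n : nat) (w : Om n) (a : 'I_n -> A), f (op w a) = op w (f \o a).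

(* Main.v *)
Require Import Defs.
From HB Require Import structures.
From mathcomp Require Import all_boot all_order all_algebra.
From mathcomp Require Import finmap monalg.
From mathcomp Require Import boolp classical_sets functions cardinality.

Set Implicit Arguments.
Unset Strict Implicit.
Unset Printing Implicit Defensive.

Import GRing.Theory.

(* Fix a finite generating valuation b of B. Since B satisfies the identities
   of A, a polynomial in the finitely many variables involved that vanishes
   under each of the finitely many valuations a of these variables in A
   vanishes under b. The kernels of these valuations thus have an intersection
   contained in ker b, and as B is prime, ker a is contained in ker b for a
   single a: B is a quotient of a subalgebra of A, so |B| <= |A|. Exchanging
   the roles of A and B gives |A| = |B|, whence a generates A and
   f(a) |-> f(b) is an isomorphism. *)

Local Open Scope classical_set_scope.
Local Open Scope ring_scope.

Section OmegaAlgebra.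
Context {k : comPzRingType} {Om : nat -> Type}.
Implicit Types A B C : omegaAlgType k Om.

(** * Evaluation of monomials and polynomials *)

Lemma dfwith_id C n (a : 'I_n -> C) (i : 'I_n) :
  @dfwith 'I_n (fun=> C) a i (a i) = a.
Proof. by apply/funext => j; case: dfwithP. Qed.

Lemma op_eq0 C n (w : Om n) (a : 'I_n -> C) (i : 'I_n) : a i = 0 -> op w a = 0.
Proof.
(* With coefficient -1 and both arguments 0, linearity in slot [i] expresses the value at 0 as its
   own negative plus itself. *)
move=> ai0; have := op_multilinear n w a i (-1) 0 0.
by rewrite scaler0 addr0 scaleN1r addNr -{1}ai0 dfwith_id.
Qed.

Lemma evalm_eq0 C (v : nat -> C) (i : nat) (u : monomial Om) :
  v i = 0 -> (0 < occ i u)%N -> evalm v u = 0.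
Proof.
move=> vi0; elim: u => [j|n w us IH] /=; first by case: eqP => // ->.
rewrite lt0n sum_nat_eq0 negb_forall => /existsP[j].
by rewrite implyTb -lt0n => /IH; apply: op_eq0.
Qed.

Lemma evalpEw C (v : nat -> C) (f : omegaPoly k Om) (D : {fset monomial Om}) :
  (msupp f `<=` D)%fset -> evalp v f = \sum_(u <- D) f@_u *: evalm v u.
Proof.
move=> fD; apply: big_fset_incl fD _ => u _ uf.
by rewrite mcoeff_outdom ?scale0r.
Qed.

Lemma evalp0 C (v : nat -> C) : evalp v (0 : {malg k[monomial Om]}) = 0.
Proof. by rewrite /evalp msupp0 big_seq_fset0. Qed.

Lemma evalpD C (v : nat -> C) (f g : {malg k[monomial Om]}) :
  evalp v (f + g) = evalp v f + evalp v g.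
Proof.
rewrite (evalpEw v (msuppD_le f g)).
rewrite (evalpEw v (fsubsetUl (msupp f) (msupp g))).
rewrite (evalpEw v (fsubsetUr (msupp f) (msupp g))) -big_split /=.
by apply: eq_bigr => u _; rewrite mcoeffD scalerDl.
Qed.

Lemma evalpU C (v : nat -> C) (c : k) (u : monomial Om) :
  evalp v (<< c *g u >> : {malg k[monomial Om]}) = c *: evalm v u.
Proof. by rewrite (evalpEw v msuppU_le) big_seq_fset1 mcoeffUU. Qed.

Lemma malg_ind (P : {malg k[monomial Om]} -> Prop) :
  P 0 -> (forall c u g, P g -> P (<< c *g u >> + g)) -> forall f, P f.
Proof.
by move=> P0 PD f; rewrite [f]monalgE; elim/big_rec: _ => // u g _; apply: PD.
Qed.

(** * Polynomial functions, uniform over all algebras *)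

(* The library makes {malg k[_]} a k-module only when 1 != 0 in k; polynomials
   are therefore handled through the functions that they induce uniformly on
   all algebras. *)
Definition polyfun (F : forall C, (nat -> C) -> C) : Prop :=
  exists f : omegaPoly k Om, forall C v, evalp v f = F C v.

Lemma polyfun_ext (F G : forall C, (nat -> C) -> C) :
  polyfun F -> (forall C v, F C v = G C v) -> polyfun G.
Proof. by move=> [f fF] FG; exists f => C v; rewrite fF. Qed.

Lemma polyfun_evalp (f : omegaPoly k Om) : polyfun (fun C v => evalp v f).
Proof. by exists f. Qed.

Lemma polyfun0 : polyfun (fun C v => 0).
Proof. by exists (0 : {malg k[monomial Om]}) => C v; rewrite evalp0. Qed.

Lemma polyfun_evalm (u : monomial Om) : polyfun (fun C v => evalm v u).
Proof.
by exists (<< 1 *g u >> : {malg k[monomial Om]}) => C v; rewrite evalpU scale1r.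
Qed.

Lemma polyfun_linear (c : k) (F G : forall C, (nat -> C) -> C) :
  polyfun F -> polyfun G -> polyfun (fun C v => c *: F C v + G C v).
Proof.
move=> [f fF] [g gG].
suff [h hE] : polyfun (fun C v => c *: evalp v f).
  exists ((h : {malg k[monomial Om]}) + g) => C v.
  by rewrite evalpD hE fF gG.
elim/malg_ind: f {fF} => [|d u f [h hE]].
  by apply: (polyfun_ext polyfun0) => C v; rewrite evalp0 scaler0.
exists ((<< c * d *g u >> : {malg k[monomial Om]}) + h) => C v.
by rewrite !evalpD hE !evalpU scalerDr scalerA.
Qed.

Lemma polyfun_op n (w : Om n) (F : 'I_n -> forall C, (nat -> C) -> C) :
  (forall j, polyfun (F j)) -> polyfun (fun C v => op w (fun j => F j C v)).
Proof.
(* Induction on the number of slots not known to be filled by a monomial; a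
   slot is reduced to the monomial case by linearity of the operation in it. *)
suff gen m : forall F : 'I_n -> forall C, (nat -> C) -> C,
    (forall j, polyfun (F j)) ->
    (forall j : 'I_n, (m <= j)%N ->
       exists u, forall C v, F j C v = evalm v u) ->
    polyfun (fun C v => op w (fun j => F j C v)).
  move=> pF; apply: (gen n) => // j.
  by rewrite leqNgt ltn_ord.
elim: m => [|m IH] {}F pF mF.
  have [us usE] := choice (fun j => mF j (leq0n j)).
  apply: (polyfun_ext (polyfun_evalm (MOp w us))) => C v /=.
  by congr op; apply/funext => j; rewrite usE.
have [mn|nm] := ltnP m n; last first.
  by apply: IH => // j mj; have := leq_trans nm mj; rewrite leqNgt ltn_ord.
pose i := Ordinal mn.
have [f fE] := pF i.
suff : polyfun (fun C v =>
    op w (@dfwith 'I_n (fun=> C) (fun j => F j C v) i (evalp v f))).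
  by move=> /polyfun_ext; apply=> C v; rewrite fE dfwith_id.
elim/malg_ind: f {fE} => [|c u g pg].
  apply: (polyfun_ext polyfun0) => C v.
  by rewrite (op_eq0 w (i := i)) // dfwith_in evalp0.
have pu : polyfun (fun C v =>
    op w (@dfwith 'I_n (fun=> C) (fun j => F j C v) i (evalm v u))).
  pose Fu j : forall C, (nat -> C) -> C :=
    if i == j then fun C v => evalm v u else F j.
  apply: (polyfun_ext (F := fun C v => op w (fun j => Fu j C v))); last first.
    move=> C v; congr op; apply/funext => j; rewrite /Fu.
    by case: dfwithP => [|j' /negPf->] //; rewrite eqxx.
  apply: IH => j; rewrite /Fu; case: eqP => [_|/eqP ij].
  - exact: polyfun_evalm.
  - exact: pF.
  - by move=> _; exists u.
  - by move=> mj; apply: mF; rewrite ltn_neqAle mj andbT.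
apply: (polyfun_ext (polyfun_linear c pu pg)) => C v.
by rewrite evalpD evalpU op_multilinear.
Qed.

Lemma polyfun_monomial (u : monomial Om) (F : nat -> forall C, (nat -> C) -> C) :
  (forall i, polyfun (F i)) ->
  polyfun (fun C v => evalm (fun i => F i C v) u).
Proof. by move=> pF; elim: u => [i|n w us IH] /=; [|apply: polyfun_op]. Qed.

(** Serves below to set all but finitely many variables to 0. *)
Lemma polyfun_subst (f : omegaPoly k Om)
    (F : nat -> forall C, (nat -> C) -> C) :
  (forall i, polyfun (F i)) ->
  polyfun (fun C v => evalp (fun i => F i C v) f).
Proof.
move=> pF; elim/malg_ind: f => [|c u g pg].
  by apply: (polyfun_ext polyfun0) => C v; rewrite evalp0.
apply: (polyfun_ext (polyfun_linear c (polyfun_monomial u pF) pg)) => C v.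
by rewrite evalpD evalpU.
Qed.

(** * Submodules, spans and simple algebras *)

Lemma submodule_sum A (I : set A) (T : Type) (r : seq T) (P : pred T)
    (F : T -> A) :
  submodule I -> (forall i, P i -> I (F i)) -> I (\sum_(i <- r | P i) F i).
Proof.
move=> [I0 Ilin] IF; elim/big_rec: _ => // i x Pi Ix.
by rewrite -[F i]scale1r; apply: Ilin => //; apply: IF.
Qed.

Lemma span_sub A (S I : set A) : submodule I -> S `<=` I -> Defs.span S `<=` I.
Proof. by move=> Imod SI x; apply. Qed.

Lemma span0 A (S : set A) : Defs.span S 0.
Proof. by move=> I [[]]. Qed.

Lemma simple_prime A : simple_alg A -> prime_alg A.
Proof.
move=> [AA0 simA] I J idI idJ I0 J0.
by have [//|->] := simA I idI; have [//|->] := simA J idJ.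
Qed.

(** * Ideals of [B] cut out by finite lists of valuations in [A] *)

Section Locus.
Context {A B : omegaAlgType k Om} (b : nat -> B).
Hypothesis b_gen : forall y : B, exists f, evalp b f = y.

(* The finite word s stands for the valuation nth 0 s. In terms of the free
   algebra, locus W is the image under b of the intersection of the kernels of
   the evaluations at the words in W. *)
Definition locus (W : seq (seq A)) : set B :=
  [set y | exists2 f, evalp b f = y &
    forall s, s \in W -> evalp (nth 0 s) f = 0].

Lemma locus_submodule W : submodule (locus W).
Proof.
split=> [|c x y [f fx f0] [g gy g0]].
  by have [z zE] := polyfun0; exists z => [|s _]; rewrite zE.
have [h hE] := polyfun_linear c (polyfun_evalp f) (polyfun_evalp g).
exists h; first by rewrite hE fx gy.
by move=> s sW; rewrite hE f0 // g0 // scaler0 addr0.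
Qed.

Lemma locus_ideal W : ideal (locus W).
Proof.
split=> [|n w a [i [fi fiE fi0]]]; first exact: locus_submodule.
(* Slot [i] must receive [fi] itself: another polynomial with the same value at [b] need not vanish
   on [W]. *)
have /choice[fs fsE] j : exists f, evalp b f = a j /\ (j = i -> f = fi).
  have [->|ji] := eqVneq j i; first by exists fi.
  by have [f fE] := b_gen (a j); exists f; split=> // /eqP; rewrite (negPf ji).
have [h hE] := polyfun_op w (fun j => polyfun_evalp (fs j)).
exists h => [|s sW]; rewrite hE.
  by congr op; apply/funext => j; have [] := fsE j.
by apply: (op_eq0 w (i := i)); rewrite (fsE i).2 // fi0.
Qed.

Lemma locus_sub W W' : {subset W <= W'} -> locus W' `<=` locus W.
Proof. by move=> WW' y [f fE f0]; exists f => // s /WW'; apply: f0. Qed.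

(** By multilinearity every monomial contains both of the first two variables. The polynomial
    substituted for the first vanishes at [s], the one for the second on [W], and a zero in one slot
    kills the whole monomial. *)
Lemma locus_mul s W : set_mul (locus [:: s]) (locus W) `<=` locus (s :: W).
Proof.
apply: span_sub (locus_submodule _) _ => y [t [f [v [mf vI ->]]]].
have [f0 f0E f00] : locus [:: s] (v 0%N) by have := vI ord0.
have [f1 f1E f10] : locus W (v 1%N) by have := vI ord_max.
have /choice[fs fsE] i :
    exists g, [/\ evalp b g = v i, i = 0%N -> g = f0 & i = 1%N -> g = f1].
  case: i => [|[|i]]; [by exists f0|by exists f1|].
  by have [g gE] := b_gen (v i.+2); exists g.
rewrite /evalp big_seq; apply: submodule_sum (locus_submodule _) _ => u uf.
have occ_u := mf u uf; rewrite -[_ *: _]addr0.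
apply: (locus_submodule _).2; last exact: (locus_submodule _).1.
have [h hE] := polyfun_monomial u (fun i => polyfun_evalp (fs i)).
exists h => [|s']; rewrite hE.
  by congr evalm; apply/funext => i; have [] := fsE i.
rewrite inE => /predU1P[->|s'W].
  apply: (evalm_eq0 (i := 0%N)); last by rewrite occ_u.
  by have [_ -> // _] := fsE 0%N; rewrite f00 ?mem_head.
apply: (evalm_eq0 (i := 1%N)); last by rewrite occ_u.
by have [_ _ -> //] := fsE 1%N; rewrite f10.
Qed.

(** Primeness splits off one word at a time: were [locus [:: s]] and [locus W] both nonzero, so
    would be their product, which lies in [locus (s :: W)]. *)
Lemma prime_locus W :
  prime_alg B -> locus W = [set 0] -> exists s, locus [:: s] = [set 0].
Proof.
move=> primeB; elim: W => [|s W IH] W0.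
  (* [locus [::]] is all of [B], so [B] is zero here and any word serves. *)
  exists [::]; apply/seteqP; split=> [y|y ->].
    by rewrite -W0; apply: locus_sub.
  exact: (locus_submodule _).1.
have [s0|s0] := pselect (locus [:: s] = [set 0]); first by exists s.
have [/IH//|locW] := pselect (locus W = [set 0]).
case: (primeB _ _ (locus_ideal [:: s]) (locus_ideal W) s0 locW).
apply/seteqP; split=> [|y ->]; last exact: span0.
by rewrite -W0; apply: locus_mul.
Qed.

End Locus.

End OmegaAlgebra.

(** * Enumeration of finite sets *)

Lemma finite_words {T : eqType} (e : seq T) (n : nat) :
  exists W : seq (seq T),
    forall s, size s = n -> {subset s <= e} -> s \in W.
Proof.
elim: n => [|n [W sW]]; first by exists [:: [::]] => -[].
exists [seq x :: s | x <- e, s <- W] => -[//|x s] [sn] xse.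
apply: allpairs_f; first by apply: xse; rewrite mem_head.
by apply: sW => // y ys; apply: xse; rewrite inE ys orbT.
Qed.

Lemma finite_setT_enum {T : choiceType} :
  finite_set [set: T] -> exists e : seq T, forall x, x \in e.
Proof.
move=> /finite_seqP[e eE]; exists e => x.
by have : [set` e] x by rewrite -eE.
Qed.

(** * Comparison of two finite prime algebras *)

Section Comparison.
Context {k : comPzRingType} {Om : nat -> Type}.
Implicit Types A B : omegaAlgType k Om.

Lemma prime_valuation {A B} :
  finite_set [set: A] -> finite_set [set: B] -> prime_alg B ->
  polyId A `<=` polyId B ->
  exists (a : nat -> A) (b : nat -> B),
    (forall y, exists f, evalp b f = y) /\
    (forall f, evalp a f = 0 -> evalp b f = 0).
Proof.
move=> /finite_setT_enum[eA inA] /finite_setT_enum[eB inB] primeB idAB.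
(* [b] lists all of [B] and takes the value 0 from index [size eB] on, as does a word of that
   length. *)
pose b := nth 0 eB.
have b_gen y : exists f, evalp b f = y.
  have [f fE] := polyfun_evalm (MVar Om (index y eB)) (k := k).
  by exists f; rewrite fE /= /b nth_index.
have [W inW] := finite_words eA (size eB).
suff W0 : locus b W = [set 0 : B].
  have [s s0] := prime_locus b_gen primeB W0; exists (nth 0 s), b; split=> // f sf.
  suff : locus b [:: s] (evalp b f) by rewrite s0.
  by exists f => // s'; rewrite inE => /eqP->.
apply/seteqP; split=> [_ [f <- f0]|y ->]; last exact: (locus_submodule b W).1.
(* Setting the variables from [size eB] on to 0 turns [f] into [g], whose value at any [v] is that
   of [f] at a word in [W]; at [b] nothing changes. *)
pose F i : forall C : omegaAlgType k Om, (nat -> C) -> C :=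
  if (i < size eB)%N then fun C v => v i else fun C v => 0.
have [|g gE] := polyfun_subst f (F := F).
  move=> i; rewrite /F; case: ifP => _; last exact: polyfun0.
  exact: (polyfun_evalm (MVar Om i)).
have /idAB/(_ b) : polyId A g.
  move=> v; rewrite gE -[RHS](f0 (mkseq v (size eB))); last first.
    by apply: inW => [|x _]; rewrite ?size_mkseq ?inA.
  congr evalp; apply/funext => i; rewrite /F; case: ltnP => im.
    by rewrite nth_mkseq.
  by rewrite nth_default // size_mkseq.
rewrite gE => <-; congr evalp; apply/funext => i; rewrite /F.
by case: ltnP => // im; rewrite /b nth_default.
Qed.

(** [f \o g] is an injective self-map of the finite [U], hence onto, so [f] is onto. *)
Lemma finite_inj_surj {T U : choiceType} (f : T -> U) (g : U -> T) :
  finite_set [set: U] -> injective f -> injective g ->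
  forall y, exists x, f x = y.
Proof.
move=> /finite_setT_enum[e ine] f_inj g_inj y.
have fg_inj : injective (f \o g) by apply: inj_comp.
have uniq_fg : uniq (map (f \o g) (undup e)).
  by rewrite map_inj_uniq ?undup_uniq.
have [||_ eqe] := uniq_min_size uniq_fg (s2 := undup e).
- by move=> x _; rewrite mem_undup.
- by rewrite size_map.
have : y \in map (f \o g) (undup e) by rewrite eqe mem_undup.
by case/mapP=> x _ ->; exists (g x).
Qed.

(** Applied to f - g, the inclusion of kernels makes the assignment f(a) |-> f(b) well defined. *)
Lemma evalp_separates {A B} (a : nat -> A) (b : nat -> B) :
  (forall f, evalp a f = 0 -> evalp b f = 0) ->
  forall f g, evalp a f = evalp a g -> evalp b f = evalp b g.
Proof.
move=> ab f g fg.
have [h hE] := polyfun_linear (-1) (polyfun_evalp g) (polyfun_evalp f).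
apply/eqP; rewrite -subr_eq0 addrC -scaleN1r -hE; apply/eqP/ab.
by rewrite hE scaleN1r fg addNr.
Qed.

(** The injection is a mere section of the quotient map from a subalgebra of [A] onto [B]; it serves
    only to compare cardinalities. *)
Lemma finite_prime_embedding {A B} :
  finite_set [set: A] -> finite_set [set: B] -> prime_alg B ->
  polyId A `<=` polyId B -> exists g : B -> A, injective g.
Proof.
move=> finA finB primeB /(prime_valuation finA finB primeB)[a [b [b_gen ab]]].
have [p pE] := choice b_gen; exists (fun y => evalp a (p y)) => y y' eqa.
by rewrite -[y]pE -[y']pE; apply: (evalp_separates ab).
Qed.

Lemma finite_prime_iso {A B} :
  finite_set [set: A] -> finite_set [set: B] ->
  prime_alg A -> prime_alg B -> polyId A = polyId B -> omega_iso A B.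
Proof.
move=> finA finB primeA primeB idAB.
have [g g_inj] : exists g : A -> B, injective g.
  by apply: finite_prime_embedding => //; rewrite idAB.
have [|a [b [b_gen ab0]]] := prime_valuation finA finB primeB.
  by rewrite idAB.
have ab := evalp_separates ab0.
have [p pE] := choice b_gen.
have p_inj : injective (fun y => evalp a (p y)).
  by move=> y y' /ab; rewrite !pE.
(* [a] generates [A]: the injection y |-> p(y)(a) from [B] to [A] is onto, since [g] injects [A]
   back into [B]. *)
have /choice[q qE] x : exists f, evalp a f = x.
  by have [y <-] := finite_inj_surj finA p_inj g_inj x; exists (p y).
pose phi x := evalp b (q x).
have phiE f : phi (evalp a f) = evalp b f by apply: ab; rewrite qE.
have phi_linear : linear phi.
  move=> c x y.
  have [h hE] := polyfun_linear c (polyfun_evalp (q x)) (polyfun_evalp (q y)).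
  by rewrite -[x in LHS]qE -[y in LHS]qE -hE phiE hE.
exists (HB.pack_for {linear A -> B} phi
  (GRing.isLinear.Build k A B *:%R phi phi_linear)).
split=> [|n w x] /=.
  exists (fun y => evalp a (p y)) => [x|y]; last by rewrite phiE pE.
  have [y <-] := finite_inj_surj finA p_inj g_inj x.
  by rewrite phiE pE.
have [h hE] := polyfun_op w (fun j => polyfun_evalp (q (x j))).
have -> : x = fun j => evalp a (q (x j)) by apply/funext => j; rewrite qE.
by rewrite -hE phiE hE; congr op; apply/funext => j /=; rewrite phiE.
Qed.

End Comparison.

(* The first conjunct is the assertion that the result applies in particular
   to simple algebras. *)
Theorem corollary9 (k : comPzRingType) (Om : nat -> Type)
    (hOm : exists2 n : nat, (2 <= n)%N & inhabited (Om n)) :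
  (forall C : omegaAlgType k Om, simple_alg C -> prime_alg C) /\
  (forall A B : omegaAlgType k Om,
    finite_set [set: A] -> finite_set [set: B] ->
    prime_alg A -> prime_alg B ->
    polyId A = polyId B ->
    omega_iso A B).
Proof.
split=> [C|A B finA finB primeA primeB]; first exact: simple_prime.
exact: finite_prime_iso.
Qed.
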